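(* Let $G$ be a Lie group with a quadratic Lie algebra $(\mathfrak g,\langle\cdot,\cdot\rangle)$, $NG_\bullet$ its nerve and $\Omega_\bullet=\Omega-\Theta+0$ with $\Omega=\langle d_2^*\theta^l,d_0^*\theta^r\rangle\in\Omega^2(G\times G)$ and $\Theta=\frac16\langle\theta^l,[\theta^l,\theta^l]\rangle\in\Omega^3(G)$. Regard the pairing $\langle\cdot,\cdot\rangle$ as an element of $S^2\mathfrak g^*=W^{2,2}\mathfrak g$. Then the Van Est map satisfies $$VE(\Omega_\bullet)=-\langle\cdot,\cdot\rangle .$$
   Context: Quadratic Lie algebra: a Lie algebra with a symmetric non-degenerate ad-invariant pairing. $\theta^l,\theta^r$ are the left/right Maurer–Cartan forms; $\Omega_{(g,h)}((v_1,v_2),(w_1,w_2))=\langle L_{g^{-1}}v_1,R_{h^{-1}}w_2\rangle-\langle L_{g^{-1}}w_1,R_{h^{-1}}v_2\rangle$. Nerve: $NG_i=G^i$, $d_0$ drops the first entry, $d_i$ the last, inner faces multiply neighbours, $s_j$ inserts $e$ after the $j$-th entry; in particular $s_0(g)=(e,g)$ on $NG_1$ and $s_0(pt)=e$. The Van Est map of Arias Abad–Crainic is a map of double complexes $VE:(\widehat\Omega^q(NG_p),\delta,d)\to(W^{p,q}\mathfrak g,d^h,d^v)$ from normalized forms (forms vanishing under pullback by degeneracies) to the bigraded Weil algebra $W^{p,q}\mathfrak g=\wedge^{p-q}\mathfrak g^*\otimes S^q\mathfrak g^*$ (zero if $q>p$). In particular $VE$ vanishes on $\widehat\Omega^3(NG_1)$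 because $W^{1,3}\mathfrak g=0$, and on $\widehat\Omega^2(NG_2)$, with values in $W^{2,2}\mathfrak g=S^2\mathfrak g^*$, it is given for $\beta$ equal to the form $\Omega$ by $$VE(\beta)(v,w)=-s_0^*\,i_{\widehat v}\,s_0^*\,i_{\widehat w}\,\beta,\qquad v,w\in\mathfrak g,$$ where $\widehat v$ is the left invariant vector field on $G$ with $\widehat v_e=v$ and $\widehat w$ is the vector field $\widehat w_{(g,h)}=(L_gw,0)$ on $G\times G$. *)

(* Defs.v *)
From HB Require Import structures.
From mathcomp Require Import all_boot all_order all_algebra all_fingroup.
From mathcomp Require Import interval_inference boolp classical_sets functions.
From mathcomp Require Import reals topology normedtype landau derive.
Set Implicit Arguments.
Unset Strict Implicit.
Unset Printing Implicit Defensive.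
Import Order.TTheory GRing.Theory Num.Theory.
Import numFieldNormedType.Exports.
Local Open Scope classical_set_scope.
Local Open Scope ring_scope.

Section Calculus.
Context {R : realType}.

(* f is C^(k+1) on the open set U when it is differentiable on U and its tangent
   map (x, v) |-> Df(x) v is C^k on U x E; for finite-dimensional E (the only
   models used below) this is the usual notion. *)
Fixpoint Ck (k : nat) (E F : normedModType R) (U : set E) (f : E -> F) : Prop :=
  if k is k'.+1 then
    (forall x, U x -> differentiable f x) /\
    @Ck k' (E * E)%type F (U `*` setT) (fun p => 'd f (p.1) p.2)
  else forall x, U x -> {for x, continuous f}.

Definition smooth_on (E F : normedModType R) (U : set E) (f : E -> F) : Prop :=
  forall k, Ck k U f.

Lemma Ck_sub k (E F : normedModType R) (U V : set E) (f : E -> F) :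
  V `<=` U -> Ck k U f -> Ck k V f.
Proof.
elim: k E F U V f => [|k IH] E F U V f VU /= => [fU x /VU/fU//|].
case=> fU kU; split; first by move=> x /VU/fU.
by apply: IH kU => -[x y] /= [/VU].
Qed.

Lemma Ck_pred k (E F : normedModType R) (U : set E) (f : E -> F) :
  Ck k.+1 U f -> Ck k U f.
Proof.
elim: k E F U f => [|k IH] E F U f.
  by case=> fU _ x /fU; apply: differentiable_continuous.
by case=> fU /IH.
Qed.

Lemma near_is_diff (E F : normedModType R) (f g : E -> F) (df : E -> F) x :
  {near x, f =1 g} -> is_diff x f df -> is_diff x g df.
Proof.
move=> fg [fx <-].
have fgx : f x = g x := nbhs_singleton fg.
suff H : g \o shift x = cst (g x) + 'd f x +o_ 0 id.
  have e := diff_unique (diff_continuous fx) H.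
  apply: DiffDef; last exact: e; apply/diff_locallyP; rewrite e; split=> //.
  exact: (diff_continuous fx).
have := (diff_locallyP x f).1 fx => -[_ H].
apply/eqaddoP => e e0.
have /eqaddoP /(_ e e0) := H.
have : \forall y \near 0, f (y + x) = g (y + x).
  have : shift x @ 0 --> x.
    rewrite -[X in _ --> X]add0r; apply: cvgD; [exact: cvg_id|exact: cvg_cst].
  by move/(_ _ fg).
apply: filterS2 => y fgy; rewrite !fctE /= fgy.
rewrite /cst/=. by rewrite fgx.
Qed.

Lemma near_diff (E F : normedModType R) (f g : E -> F) x :
  {near x, f =1 g} -> differentiable f x -> 'd g x = 'd f x :> (E -> F).
Proof.
move=> fg df; suff [] : is_diff x g ('d f x) by [].
by apply: near_is_diff fg _; apply: DiffDef.
Qed.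

Lemma open_setX (T S : topologicalType) (A : set T) (B : set S) :
  open A -> open B -> open (A `*` B).
Proof.
rewrite !openE => oA oB [x y] [/= /oA Ax /oB By].
by exists (A, B).
Qed.

Lemma Ck_ext k (E F : normedModType R) (U : set E) (f g : E -> F) :
  open U -> {in U, f =1 g} -> Ck k U f -> Ck k U g.
Proof.
elim: k E F U f g => [|k IH] E F U f g oU fg /=.
  move=> fU x Ux; have fx := fU _ Ux.
  rewrite /prop_for /continuous_at -(fg x) ?inE//.
  have /near_eq_cvg h : {near x, f =1 g}.
    by apply: filterS (open_nbhs_nbhs (conj oU Ux)) => y Uy; rewrite fg ?inE.
  by move: h fx; rewrite /prop_for /continuous_at; exact: cvg_trans.
have fgn x : U x -> {near x, f =1 g}.
  by move=> Ux; apply: filterS (open_nbhs_nbhs (conj oU Ux)) => y Uy; rewrite fg ?inE.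
case=> fU kU.
have d x : U x -> is_diff x g ('d f x).
  move=> Ux; apply: near_is_diff (fgn _ Ux) _; apply: DiffDef => //; exact: fU.
split; first by move=> x /d [].
apply: IH kU; first by apply: open_setX => //; exact: openT.
move=> [x y]; rewrite inE => -[/= Ux _].
exact: (esym (congr1 (fun h => h y) (@diff_val _ _ _ _ _ _ _ (d _ Ux)))).
Qed.

Lemma Ck_lin k (E F : normedModType R) (U : set E) (f : {linear E -> F}) :
  continuous f -> Ck k U f.
Proof.
elim: k E F U f => [|k IH] E F U f cf /=; first by move=> x _; apply: cf.
split; first by move=> x _; apply: linear_differentiable.
have -> : (fun p : E * E => 'd f (p.1) p.2) = (fun p => f p.2).
  by apply: funext => p; rewrite diff_lin.
apply: (IH _ F (U `*` setT) (f \o snd : {linear (E * E)%type -> F})).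
by move=> x; apply: continuous_comp; [exact: cvg_snd|exact: cf].
Qed.

Lemma Ck_cst k (E F : normedModType R) (U : set E) (a : F) : Ck k U (cst a).
Proof.
elim: k E F U a => [|k IH] E F U a /=; first by move=> x _; apply: cst_continuous.
split=> [x _|]; first exact: differentiable_cst.
have -> : (fun p : E * E => 'd (cst a) (p.1) p.2) = cst (0 : F).
  by apply: funext => p; rewrite diff_cst.
exact: IH.
Qed.

Lemma Ck_pair k (E F G : normedModType R) (U : set E) (f : E -> F) (g : E -> G) :
  open U -> Ck k U f -> Ck k U g -> Ck k U (fun x => (f x, g x)).
Proof.
elim: k E F G U f g => [|k IH] E F G U f g oU /=.
  move=> fU gU x Ux; apply: cvg_pair; [exact: fU|exact: gU].
move=> [fU kf] [gU kg]; split=> [x Ux|].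
  by apply: differentiable_pair; auto.
have oUT : open (U `*` [set: E]) by apply: open_setX => //; exact: openT.
apply: Ck_ext (IH _ _ _ _ _ _ oUT kf kg) => // -[x y]; rewrite inE => -[/= Ux _].
by rewrite diff_pair; auto.
Qed.

Lemma Ck_fst k (E F : normedModType R) (U : set (E * F)) : Ck k U fst.
Proof. by apply: (@Ck_lin k _ _ U (fst : {linear (E * F)%type -> E})) => x; exact: cvg_fst. Qed.
Lemma Ck_snd k (E F : normedModType R) (U : set (E * F)) : Ck k U snd.
Proof. by apply: (@Ck_lin k _ _ U (snd : {linear (E * F)%type -> F})) => x; exact: cvg_snd. Qed.

Lemma Ck_comp k (E F G : normedModType R) (U : set E) (V : set F)
    (f : E -> F) (g : F -> G) :
  open U -> open V -> f @` U `<=` V -> Ck k U f -> Ck k V g -> Ck k U (g \o f).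
Proof.
elim: k E F G U V f g => [|k IH] E F G U V f g oU oV fUV.
  move=> fU gV x Ux; apply: continuous_comp; first exact: fU.
  by apply: gV; apply: fUV; exists x.
move=> fk gk; have fk' := Ck_pred fk; case: fk gk => fU kf [gV kg].
split=> [x Ux|].
  by apply: differentiable_comp; [exact: fU|apply: gV; apply: fUV; exists x].
have oUT : open (U `*` [set: E]) by apply: open_setX => //; exact: openT.
have oVT : open (V `*` [set: F]) by apply: open_setX => //; exact: openT.
apply: (@Ck_ext _ _ _ _ ((fun p : F * F => 'd g (p.1) p.2) \o
   (fun p : E * E => (f p.1, 'd f (p.1) p.2)))) => //.
  move=> [x y]; rewrite inE => -[/= Ux _].
  have gfx : differentiable g (f x) by apply: gV; apply: fUV; exists x.
  by rewrite (diff_comp (fU _ Ux) gfx).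
apply: (IH _ _ _ _ _ _ _ oUT oVT _ _ kg).
  by move=> _ [[x y] [/= Ux _] <-] /=; split=> //=; apply: fUV; exists x.
apply: Ck_pair => //.
apply: (IH _ _ _ _ U fst f oUT oU _ _ fk'); last exact: Ck_fst.
by move=> _ [[x y] [/= Ux _] <-].
Qed.

Lemma Ck_local k (E F : normedModType R) (U : set E) (f : E -> F) :
  (forall x, U x -> exists V, [/\ open V, V x & Ck k V f]) -> Ck k U f.
Proof.
elim: k E F U f => [|k IH] E F U f Uf /=.
  by move=> x /Uf [V [_ Vx]]; apply.
split=> [x /Uf [V [_ Vx [fV _]]]|]; first exact: fV.
apply: IH => -[x y] [/= /Uf [V [oV Vx [_ kV]]] _].
by exists (V `*` setT); split=> //; apply: open_setX => //; exact: openT.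
Qed.

Lemma Ck_comp2 k (E F1 F2 G : normedModType R) (U : set E) (V : set (F1 * F2))
    (f1 : E -> F1) (f2 : E -> F2) (g : F1 * F2 -> G) :
  open U -> open V -> (forall x, U x -> V (f1 x, f2 x)) ->
  Ck k U f1 -> Ck k U f2 -> Ck k V g -> Ck k U (fun x => g (f1 x, f2 x)).
Proof.
move=> oU oV UV k1 k2 kg.
apply: (@Ck_comp _ _ _ _ U V (fun x => (f1 x, f2 x)) g) => //.
  by move=> _ [x /UV Vx <-].
exact: Ck_pair.
Qed.

Lemma smooth_on_differentiable (E F : normedModType R) (U : set E) (f : E -> F) x :
  smooth_on U f -> U x -> differentiable f x.
Proof. by move=> fU Ux; have [+ _] := fU 1; apply. Qed.

Lemma Ck_add k (E F : normedModType R) (U : set E) (f g : E -> F) :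
  open U -> Ck k U f -> Ck k U g -> Ck k U (fun x => f x + g x).
Proof.
move=> oU kf kg.
have lin : linear (fun p : F * F => p.1 + p.2).
  by move=> a [x1 x2] [y1 y2] /=; rewrite scalerDr addrACA.
pose addM := GRing.isLinear.Build _ _ _ _ _ lin.
pose addL : {linear _ -> _} := HB.pack (fun p : F * F => p.1 + p.2) addM.
apply: (@Ck_comp2 _ _ _ _ _ U setT f g addL) => //; first exact: openT.
apply: Ck_lin => -[x y]; exact: add_continuous.
Qed.

Lemma Ck_scalel k (E F : normedModType R) (U : set E) (f : E -> R) (w : F) :
  open U -> Ck k U f -> Ck k U (fun x => f x *: w).
Proof.
move=> oU kf.
have lin : linear (fun a : R => a *: w).
  by move=> u y z; rewrite scalerDl scalerA.
pose sM := GRing.isLinear.Build _ _ _ _ _ lin.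
pose sL : {linear _ -> _} := HB.pack (fun a : R => a *: w) sM.
apply: (@Ck_comp _ _ _ _ U setT f sL) => //; first exact: openT.
apply: Ck_lin => a; exact: scalel_continuous.
Qed.

Lemma Ck_scaler k (E F : normedModType R) (U : set E) (f : E -> F) (a : R) :
  open U -> Ck k U f -> Ck k U (fun x => a *: f x).
Proof.
move=> oU kf; apply: (@Ck_comp _ _ _ _ U setT f ( *:%R a : {linear F -> F})) => //.
  exact: openT.
by apply: Ck_lin => x; exact: scaler_continuous.
Qed.

Lemma Ck_mul k (E : normedModType R) (U : set E) (f g : E -> R) :
  open U -> Ck k U f -> Ck k U g -> Ck k U (fun x => f x * g x).
Proof.
elim: k E U f g => [|k IH] E U f g oU.
  by move=> fU gU x Ux; apply: cvgM; [exact: fU|exact: gU].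
move=> fk gk; have fk' := Ck_pred fk; have gk' := Ck_pred gk.
case: fk gk => fU kf [gU kg]; split.
  by move=> x Ux; apply: differentiableM; auto.
have oUT : open (U `*` [set: E]) by apply: open_setX => //; exact: openT.
have sub (h : E -> R) : Ck k U h -> Ck k (U `*` [set: E]) (fun p => h p.1).
  move=> kh; apply: (@Ck_comp _ _ _ _ (U `*` setT) U fst h) => //; last exact: Ck_fst.
  by move=> _ [[x y] [/= Ux _] <-].
apply: (@Ck_ext _ _ _ _ (fun p : E * E =>
   f p.1 * 'd g (p.1) p.2 + g p.1 * 'd f (p.1) p.2)) => //.
  move=> [x y]; rewrite inE => -[/= Ux _].
  exact: (esym (congr1 (fun h => h y) (diffM (fU _ Ux) (gU _ Ux)))).
apply: (Ck_add oUT).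
  exact: (IH _ _ (fun p => f p.1) (fun p => 'd g (p.1) p.2) oUT (sub f fk') kg).
exact: (IH _ _ (fun p => g p.1) (fun p => 'd f (p.1) p.2) oUT (sub g gk') kf).
Qed.

Lemma Ck_sum k (E F : normedModType R) (U : set E) (I : finType) (f : I -> E -> F) :
  open U -> (forall i, Ck k U (f i)) -> Ck k U (fun x => \sum_i f i x).
Proof.
move=> oU kf.
suff H (s : seq I) : Ck k U (fun x => \sum_(i <- s) f i x) by apply: H.
elim: s => [|i s IH].
  rewrite (_ : (fun x => _) = cst 0); first exact: Ck_cst.
  by apply: funext => x; rewrite big_nil.
rewrite (_ : (fun x => _) = (fun x => f i x + \sum_(i <- s) f i x)).
  exact: Ck_add.
by apply: funext => x; rewrite big_cons.
Qed.

Lemma Ck_bilin k n m (E F : normedModType R) (U : set E)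
    (B : 'rV[R]_n -> 'rV[R]_m -> F) (f : E -> 'rV[R]_n) (g : E -> 'rV[R]_m) :
  (forall u, linear (B u)) -> (forall w, linear (B^~ w)) ->
  open U -> Ck k U f -> Ck k U g -> Ck k U (fun x => B (f x) (g x)).
Proof.
move=> Br Bl oU kf kg.
have BE u w : B u w = \sum_i \sum_j
    (u 0 i * w 0 j) *: B (delta_mx 0 i) (delta_mx 0 j).
  pose L w := HB.pack_for {linear 'rV[R]_n -> F} (B^~ w)
    (GRing.isLinear.Build _ _ _ _ _ (Bl w)).
  pose L' u := HB.pack_for {linear 'rV[R]_m -> F} (B u)
    (GRing.isLinear.Build _ _ _ _ _ (Br u)).
  rewrite [u in LHS]row_sum_delta -[LHS]/(L w _) linear_sum; apply: eq_bigr => i _.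
  rewrite linearZ /= [w in LHS]row_sum_delta -[B _ _]/(L' (delta_mx 0 i) _) linear_sum scaler_sumr.
  by apply: eq_bigr => j _; rewrite linearZ /= scalerA.
rewrite (_ : (fun x => _) = (fun x => \sum_i \sum_j
    (f x 0 i * g x 0 j) *: B (delta_mx 0 i) (delta_mx 0 j))); last first.
  by apply: funext => x; exact: BE.
have coord p (h : E -> 'rV[R]_p) i : Ck k U h -> Ck k U (fun x => h x 0 i).
  move=> kh.
  have lin : linear (fun v : 'rV[R]_p => v 0 i : R).
    by move=> a x y; rewrite !mxE.
  pose cM := GRing.isLinear.Build _ _ _ _ _ lin.
  pose cL : {linear _ -> _} := HB.pack (fun v : 'rV[R]_p => v 0 i : R) cM.
  apply: (@Ck_comp _ _ _ _ U setT h cL) => //; first exact: openT.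
  apply: Ck_lin => v; exact: coord_continuous.
apply: Ck_sum => // i; apply: Ck_sum => // j; apply: Ck_scalel => //.
by apply: Ck_mul => //; apply: coord.
Qed.

Lemma diff_lincomb (E F : normedModType R) (f g : E -> F) (a : R) x u :
  differentiable f x -> differentiable g x ->
  'd (a *: f + g) x u = a *: 'd f x u + 'd g x u.
Proof.
move=> df dg; have daf := differentiableZ a df.
have e1 := congr1 (fun h => h u) (diffD daf dg).
have e2 := congr1 (fun h => h u) (diffZ a df).
exact: (etrans e1 (congr1 (fun z => z + 'd g x u) e2)).
Qed.

Lemma diff_fst (E F : normedModType R) (p : E * F) :
  'd fst p = fst :> (E * F -> E).
Proof. by rewrite (@diff_lin _ _ _ (fst : {linear (E * F)%type -> E})) // => x; exact: cvg_fst. Qed.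

Lemma diff_snd (E F : normedModType R) (p : E * F) :
  'd snd p = snd :> (E * F -> F).
Proof. by rewrite (@diff_lin _ _ _ (snd : {linear (E * F)%type -> F})) // => x; exact: cvg_snd. Qed.

Lemma differentiable_fst (E F : normedModType R) (p : E * F) :
  differentiable (fst : E * F -> E) p.
Proof. by apply: (@linear_differentiable _ _ _ (fst : {linear (E * F)%type -> E})) => x; exact: cvg_fst. Qed.

Lemma differentiable_snd (E F : normedModType R) (p : E * F) :
  differentiable (snd : E * F -> F) p.
Proof. by apply: (@linear_differentiable _ _ _ (snd : {linear (E * F)%type -> F})) => x; exact: cvg_snd. Qed.

Lemma diff_partial (E1 E2 F : normedModType R) (P : E1 * E2 -> F) z y :
  differentiable P (z, y) ->
  'd (fun y => P (z, y)) y = (fun u => 'd P (z, y) (0, u)) :> (E2 -> F).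
Proof.
move=> dP.
have dz : differentiable (cst z : E2 -> E1) y by exact: differentiable_cst.
have di : differentiable (id : E2 -> E2) y by exact: ex_diff.
have dp := differentiable_pair dz di.
rewrite (@diff_comp _ _ _ _ (fun y => (cst z y, id y)) P y dp dP).
apply: funext => u /=; rewrite (@diff_pair _ _ _ _ _ id _ dz di) diff_cst.
by rewrite (@diff_val _ _ _ _ _ id id).
Qed.

End Calculus.

Section Manifolds.
Context {R : realType}.

(* cmap and cinv are total functions; they are only meaningful on cdom and on
   its image. *)
Record chart (M : topologicalType) (E : normedModType R) := Chart {
  cdom : set M;
  cmap : M -> E;
  cinv : E -> M;
  cdom_open : open cdom;
  cimg_open : open (cmap @` cdom);
  cmapK : forall x, cdom x -> cinv (cmap x) = x;
  cmap_continuous : forall x, cdom x -> {for x, continuous cmap};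
  cinv_continuous : forall y, (cmap @` cdom) y -> {for y, continuous cinv}
}.

Definition cimg M E (c : chart M E) : set E := cmap c @` cdom c.

Record manifold (E : normedModType R) := Manifold {
  mspace :> topologicalType;
  atlas : set (chart mspace E);
  chart_at : mspace -> chart mspace E;
  atlas_chart_at : forall x, atlas (chart_at x);
  mem_chart_at : forall x, cdom (chart_at x) x;
  atlas_compatible : forall c d, atlas c -> atlas d ->
    smooth_on (cmap c @` (cdom c `&` cdom d)) (cmap d \o cinv c)
}.

Definition smooth_map (E F : normedModType R) (M : manifold E) (N : manifold F)
    (f : M -> N) : Prop :=
  continuous f /\
  forall c d, atlas c -> atlas d ->
    smooth_on (cmap c @` (cdom c `&` f @^-1` cdom d)) (cmap d \o f \o cinv c).

(* The tangent space at x is identified with the model space by means of the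
   preferred chart chart_at x. *)
Definition tangent_map (E F : normedModType R) (M : manifold E) (N : manifold F)
    (f : M -> N) (x : M) : {linear E -> F} :=
  'd (cmap (chart_at (f x)) \o f \o cinv (chart_at x)) (cmap (chart_at x) x).

Section ChartTheory.
Variables (M : topologicalType) (E : normedModType R) (c : chart M E).

Lemma cimgP y : cimg c y -> cdom c (cinv c y) /\ cmap c (cinv c y) = y.
Proof. by move=> [x cx <-]; rewrite cmapK. Qed.

Lemma cimg_cmap x : cdom c x -> cimg c (cmap c x).
Proof. by exists x. Qed.

Lemma cimg_pre (W : set M) : cmap c @` (cdom c `&` W) =
  cimg c `&` cinv c @^-1` W.
Proof.
apply/seteqP; split=> [_ [x [cx Wx] <-]|y [[x cx <-]]] /=.
  by split; [exists x|rewrite cmapK].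
by rewrite /= cmapK // => Wx; exists x.
Qed.

Lemma open_chart_img (W : set M) : open W -> open (cmap c @` (cdom c `&` W)).
Proof.
move=> oW; rewrite cimg_pre openE => y [cy Wy].
apply: filterI; first exact: (open_nbhs_nbhs (conj (cimg_open c) cy)).
by apply: (cinv_continuous cy); exact: open_nbhs_nbhs.
Qed.
End ChartTheory.

Definition id_chart (E : normedModType R) : chart E E.
Proof.
apply: (@Chart E E setT id id); rewrite ?image_id //; try exact: openT.
- by move=> x _; exact: cvg_id.
- by move=> x _; exact: cvg_id.
Defined.

Definition vect_manifold (E : normedModType R) : manifold E.
Proof.
apply: (@Manifold E E [set id_chart E] (fun=> id_chart E)) => // c d -> -> k.
exact: (@Ck_lin _ k E E _ idfun (fun=> cvg_id)).
Defined.

Section Product.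
Variables (E F : normedModType R).

Lemma prod_cimg (M N : topologicalType) (c : chart M E) (d : chart N F) A B :
  (fun p : M * N => (cmap c p.1, cmap d p.2)) @` (A `*` B) =
  (cmap c @` A) `*` (cmap d @` B).
Proof.
apply/seteqP; split=> [_ [[x y] [/= cx dy] <-]|[u v] [/= [x cx <-] [y dy <-]]].
  by split=> /=; [exists x|exists y].
by exists (x, y).
Qed.

Definition prod_chart (M N : topologicalType) (c : chart M E) (d : chart N F) :
  chart (M * N)%type (E * F)%type.
Proof.
apply: (@Chart (M * N)%type (E * F)%type (cdom c `*` cdom d)
  (fun p => (cmap c p.1, cmap d p.2)) (fun q => (cinv c q.1, cinv d q.2))).
- by apply: open_setX; exact: cdom_open.
- by rewrite prod_cimg; apply: open_setX; exact: cimg_open.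
- by move=> [x y] [/= cx dy]; rewrite !cmapK.
- move=> [x y] [/= cx dy]; apply: cvg_pair.
    by apply: continuous_comp; [exact: cvg_fst|exact: cmap_continuous].
  by apply: continuous_comp; [exact: cvg_snd|exact: cmap_continuous].
- rewrite prod_cimg; move=> [x y] [/= cx dy]; apply: cvg_pair.
    by apply: continuous_comp; [exact: cvg_fst|exact: cinv_continuous].
  by apply: continuous_comp; [exact: cvg_snd|exact: cinv_continuous].
Defined.

Definition prod_manifold (M : manifold E) (N : manifold F) :
  manifold (E * F)%type.
Proof.
apply: (@Manifold (E * F)%type (M * N)%type
  [set e | exists c d, [/\ atlas c, atlas d & e = prod_chart c d]]
  (fun p => prod_chart (chart_at p.1) (chart_at p.2))).
- by move=> [x y]; exists (chart_at x), (chart_at y); split=> //;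
    exact: atlas_chart_at.
- by move=> [x y]; split; exact: mem_chart_at.
- move=> _ _ [c [d [ac ad ->]]] [c' [d' [ac' ad' ->]]] k /=.
  rewrite -setXI prod_cimg.
  have o1 : open (cmap c @` (cdom c `&` cdom c')).
    exact/open_chart_img/cdom_open.
  have o2 : open (cmap d @` (cdom d `&` cdom d')).
    exact/open_chart_img/cdom_open.
  have o12 := open_setX o1 o2.
  apply: Ck_pair => //.
    apply: (Ck_comp o12 o1 _ (@Ck_fst _ _ _ _ _) (atlas_compatible ac ac' _)).
    by move=> _ [[u v] [/= ? _] <-].
  apply: (Ck_comp o12 o2 _ (@Ck_snd _ _ _ _ _) (atlas_compatible ad ad' _)).
  by move=> _ [[u v] [/= _ ?] <-].
Defined.
End Product.

Section SmoothMaps.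
Variables (E F : normedModType R) (M : manifold E) (N : manifold F).

Lemma smooth_map_id : smooth_map (M := M) (N := M) id.
Proof. by split=> [x|c d ac ad]; [exact: cvg_id|exact: atlas_compatible]. Qed.

Lemma smooth_map_cst (y : N) : smooth_map (M := M) (N := N) (fun=> y).
Proof.
split=> [x|c d ac ad k]; first exact: cst_continuous.
exact: Ck_cst.
Qed.

Lemma open_chart_preimg (c : chart M E) (f : M -> N) (d : chart N F) :
  continuous f -> open (cmap c @` (cdom c `&` f @^-1` cdom d)).
Proof.
move=> cf; apply: open_chart_img; apply: open_comp => [x _|]; first exact: cf.
exact: cdom_open.
Qed.

Lemma tangent_map_chart (f : M -> N) (c : chart M E) (y : E) :
  smooth_map f -> atlas c -> cimg c y ->
  'd (cmap (chart_at (f (cinv c y))) \o f \o cinv c) y =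
  tangent_map f (cinv c y) \o
  'd (cmap (chart_at (cinv c y)) \o cinv c) y :> (E -> F).
Proof.
move=> [cf sf] ac /cimgP [cx cy]; set x := cinv c y in cx cy *.
set cx' := chart_at x; set d := chart_at (f x).
have acx : atlas cx' := atlas_chart_at x.
have dcx : cdom cx' x := mem_chart_at x.
have dfx : cdom d (f x) := mem_chart_at (f x).
have dT : differentiable (cmap cx' \o cinv c) y.
  apply: (smooth_on_differentiable (atlas_compatible ac acx)).
  by exists x.
have dF : differentiable (cmap d \o f \o cinv cx') (cmap cx' x).
  apply: (smooth_on_differentiable (sf _ _ acx (atlas_chart_at (f x)))).
  by exists x.
have dF' : differentiable (cmap d \o f \o cinv cx') ((cmap cx' \o cinv c) y) by [].
have oV : open (cmap c @` (cdom c `&` cdom cx')) by exact/open_chart_img/cdom_open.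
have nr : {near y, (cmap d \o f \o cinv cx') \o (cmap cx' \o cinv c)
                   =1 cmap d \o f \o cinv c}.
  have Vy : (cmap c @` (cdom c `&` cdom cx')) y by exists x.
  apply: filterS (open_nbhs_nbhs (conj oV Vy)) => _ [z [cz cz'] <-] /=.
  by rewrite !cmapK.
by rewrite (near_diff nr (differentiable_comp dT dF')) (diff_comp dT dF').
Qed.

Lemma differentiable_chart (f : M -> N) (c : chart M E) (d : chart N F) (y : E) :
  smooth_map f -> atlas c -> atlas d -> cimg c y -> cdom d (f (cinv c y)) ->
  differentiable (cmap d \o f \o cinv c) y.
Proof.
move=> [cf sf] ac ad cy dy; apply: (smooth_on_differentiable (sf _ _ ac ad)).
by rewrite cimg_pre.
Qed.

Lemma chart_tangent_map (f : M -> N) (d : chart N F) (x : M) :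
  smooth_map f -> atlas d -> cdom d (f x) ->
  'd (cmap d \o f \o cinv (chart_at x)) (cmap (chart_at x) x) =
  'd (cmap d \o cinv (chart_at (f x))) (cmap (chart_at (f x)) (f x)) \o
  tangent_map f x :> (E -> F).
Proof.
move=> sf ad dfx; set c := chart_at x; set e := chart_at (f x).
have ae : atlas e := atlas_chart_at _.
have dx : cdom c x := mem_chart_at x.
have efx : cdom e (f x) := mem_chart_at (f x).
have dT : differentiable (cmap e \o f \o cinv c) (cmap c x).
  apply: differentiable_chart; rewrite ?cmapK //; first exact: atlas_chart_at.
  exact: cimg_cmap.
have eT : (cmap e \o f \o cinv c) (cmap c x) = cmap e (f x) by rewrite /= cmapK.
have dF : differentiable (cmap d \o cinv e) ((cmap e \o f \o cinv c) (cmap c x)).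
  rewrite eT; apply: (smooth_on_differentiable (atlas_compatible ae ad)).
  by exists (f x).
have [cf _] := sf.
have oV : open (cmap c @` (cdom c `&` f @^-1` cdom e)) by exact: open_chart_preimg.
have nr : {near (cmap c x), (cmap d \o cinv e) \o (cmap e \o f \o cinv c)
                   =1 cmap d \o f \o cinv c}.
  have Vy : (cmap c @` (cdom c `&` f @^-1` cdom e)) (cmap c x) by exists x.
  apply: filterS (open_nbhs_nbhs (conj oV Vy)) => _ [z [cz ez] <-] /=.
  by rewrite !cmapK.
by rewrite (near_diff nr (differentiable_comp dT dF)) (diff_comp dT dF) eT.
Qed.
End SmoothMaps.

Section SmoothMaps2.
Variables (E F H : normedModType R) (M : manifold E) (N : manifold F) (P : manifold H).

Lemma smooth_map_comp (f : M -> N) (g : N -> P) :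
  smooth_map f -> smooth_map g -> smooth_map (g \o f).
Proof.
move=> [cf sf] [cg sg]; have cgf : continuous (g \o f).
  by move=> x; apply: continuous_comp; [exact: cf|exact: cg].
split=> // c e ac ae k; apply: Ck_local => _ [x [cx ex] <-].
set d := chart_at (f x).
have ad : atlas d := atlas_chart_at _.
have oW : open (f @^-1` cdom d `&` (g \o f) @^-1` cdom e).
  by apply: openI; apply: open_comp => [y _|]; try exact: cdom_open;
    [exact: cf|exact: cgf].
have oV := open_chart_img c oW.
exists (cmap c @` (cdom c `&` (f @^-1` cdom d `&` (g \o f) @^-1` cdom e))).
split=> //; first by exists x => //; split=> //; split=> //; exact: mem_chart_at.
have o2 := open_chart_preimg d e cg.
apply: (@Ck_ext _ _ _ _ _ ((cmap e \o g \o cinv d) \o (cmap d \o f \o cinv c))) => //.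
  by move=> y; rewrite inE => -[z [cz [dz ez]] <-] /=; rewrite !cmapK.
apply: (Ck_comp oV o2 _ _ (sg _ _ ad ae k)).
  move=> _ [_ [z [cz [dz ez]] <-] <-] /=; rewrite cmapK //.
  by exists (f z).
apply: Ck_sub (sf _ _ ac ad k) => _ [z [cz [dz ez]] <-].
by exists z.
Qed.

Lemma smooth_map_pair (f : M -> N) (g : M -> P) :
  smooth_map f -> smooth_map g ->
  smooth_map (N := prod_manifold N P) (fun x => (f x, g x)).
Proof.
move=> [cf sf] [cg sg]; have cfg : continuous (fun x => (f x, g x)).
  by move=> x; apply: cvg_pair; [exact: cf|exact: cg].
split=> // c _ ac [d1 [d2 [a1 a2 ->]]] k.
apply: (@Ck_pair _ _ _ _ _ _ (cmap d1 \o f \o cinv c) (cmap d2 \o g \o cinv c)).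
- exact: (open_chart_preimg (N := prod_manifold N P) c (prod_chart d1 d2) cfg).
- by apply: Ck_sub (sf _ _ ac a1 k) => _ [z [cz [/= dz _]] <-]; exists z.
- by apply: Ck_sub (sg _ _ ac a2 k) => _ [z [cz [/= _ dz]] <-]; exists z.
Qed.

Lemma smooth_map_fst : smooth_map (M := prod_manifold N P) (N := N) fst.
Proof.
split=> [x|_ d [c1 [c2 [a1 a2 ->]]] ad k]; first exact: cvg_fst.
have o1 : open (cmap c1 @` (cdom c1 `&` cdom d)) by exact/open_chart_img/cdom_open.
apply: (Ck_comp _ o1 _ (@Ck_fst _ _ _ _ _) (atlas_compatible a1 ad k)).
  by apply: (open_chart_preimg (M := prod_manifold N P) (N := N)) => x; exact: cvg_fst.
by move=> _ [_ [[z1 z2] [[/= ? ?] ?] <-] <-] /=; exists z1.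
Qed.

Lemma smooth_map_snd : smooth_map (M := prod_manifold N P) (N := P) snd.
Proof.
split=> [x|_ d [c1 [c2 [a1 a2 ->]]] ad k]; first exact: cvg_snd.
have o1 : open (cmap c2 @` (cdom c2 `&` cdom d)) by exact/open_chart_img/cdom_open.
apply: (Ck_comp _ o1 _ (@Ck_snd _ _ _ _ _) (atlas_compatible a2 ad k)).
  by apply: (open_chart_preimg (M := prod_manifold N P) (N := P)) => x; exact: cvg_snd.
by move=> _ [_ [[z1 z2] [[/= ? ?] ?] <-] <-] /=; exists z2.
Qed.
End SmoothMaps2.

Section TangentMaps.
Variables (E F H : normedModType R) (M : manifold E) (N : manifold F) (P : manifold H).

Lemma chart_near_id (c : chart M E) x : cdom c x ->
  'd (cmap c \o cinv c) (cmap c x) = id :> (E -> E).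
Proof.
move=> cx; have nr : {near (cmap c x), id =1 cmap c \o cinv c}.
  have cy : cimg c (cmap c x) by exists x.
  apply: filterS (open_nbhs_nbhs (conj (cimg_open c) cy)) => _ [z cz <-] /=.
  by rewrite cmapK.
by rewrite (near_diff nr) ?diff_val.
Qed.

Lemma tangent_map_id (x : M) : tangent_map (N := M) id x = id :> (E -> E).
Proof. exact: (chart_near_id (mem_chart_at x)). Qed.

Lemma tangent_map_cst (y : N) (x : M) :
  tangent_map (fun=> y) x = (fun=> 0) :> (E -> F).
Proof. exact: (@diff_cst R E F). Qed.

Lemma tangent_map_comp (f : M -> N) (g : N -> P) x :
  smooth_map f -> smooth_map g ->
  tangent_map (g \o f) x = tangent_map g (f x) \o tangent_map f x :> (E -> H).
Proof.
move=> sf sg; rewrite /tangent_map /=.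
set c := chart_at x; set d := chart_at (f x); set e := chart_at (g (f x)).
have cx : cdom c x := mem_chart_at x.
have dfx : cdom d (f x) := mem_chart_at _.
have egx : cdom e (g (f x)) := mem_chart_at _.
have dT : differentiable (cmap d \o f \o cinv c) (cmap c x).
  by apply: differentiable_chart; rewrite ?cmapK //; try exact: atlas_chart_at;
    exact: cimg_cmap.
have eT : (cmap d \o f \o cinv c) (cmap c x) = cmap d (f x) by rewrite /= cmapK.
have dF : differentiable (cmap e \o g \o cinv d) ((cmap d \o f \o cinv c) (cmap c x)).
  by rewrite eT; apply: differentiable_chart; rewrite ?cmapK //;
    try exact: atlas_chart_at; exact: cimg_cmap.
have oV : open (cmap c @` (cdom c `&` f @^-1` cdom d)).
  by apply: open_chart_preimg; case: sf.
have nr : {near (cmap c x), (cmap e \o g \o cinv d) \o (cmap d \o f \o cinv c)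
                   =1 cmap e \o (g \o f) \o cinv c}.
  have Vy : (cmap c @` (cdom c `&` f @^-1` cdom d)) (cmap c x) by exists x.
  apply: filterS (open_nbhs_nbhs (conj oV Vy)) => _ [z [cz ez] <-] /=.
  by rewrite !cmapK.
by rewrite (near_diff nr (differentiable_comp dT dF)) (diff_comp dT dF) eT.
Qed.

Lemma tangent_map_fst (p : prod_manifold N P) :
  tangent_map (M := prod_manifold N P) (N := N) fst p = fst :> (F * H -> F).
Proof.
set c := chart_at p; have cp : cdom c p := mem_chart_at p.
have nr : {near (cmap c p), fst =1 cmap (chart_at p.1) \o fst \o cinv c}.
  have cy : cimg c (cmap c p) by exists p.
  apply: filterS (open_nbhs_nbhs (conj (cimg_open c) cy)) => _ [z [cz ?] <-] /=.
  by rewrite cmapK.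
rewrite /tangent_map -/c (near_diff nr) ?diff_fst //.
exact: differentiable_fst.
Qed.

Lemma tangent_map_snd (p : prod_manifold N P) :
  tangent_map (M := prod_manifold N P) (N := P) snd p = snd :> (F * H -> H).
Proof.
set c := chart_at p; have cp : cdom c p := mem_chart_at p.
have nr : {near (cmap c p), snd =1 cmap (chart_at p.2) \o snd \o cinv c}.
  have cy : cimg c (cmap c p) by exists p.
  apply: filterS (open_nbhs_nbhs (conj (cimg_open c) cy)) => _ [z [? cz] <-] /=.
  by rewrite cmapK.
rewrite /tangent_map -/c (near_diff nr) ?diff_snd //.
exact: differentiable_snd.
Qed.

Lemma smooth_map_slice (h : prod_manifold N P -> M) (a : N) :
  smooth_map h -> smooth_map (M := P) (fun x => h (a, x)).
Proof.
move=> sh; apply: (@smooth_map_comp _ _ _ _ (prod_manifold N P) _ (fun x => (a, x)) h) => //.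
by apply: smooth_map_pair; [exact: smooth_map_cst|exact: smooth_map_id].
Qed.
End TangentMaps.
End Manifolds.

Section LieGroups.
Context {R : realType}.

Section Multilinear.
Variables (E : lmodType R) (V : lmodType R) (k : nat).

Definition subst_at (v : 'I_k -> E) (i : 'I_k) (x : E) : 'I_k -> E :=
  fun j => if j == i then x else v j.

Definition multilinear (w : ('I_k -> E) -> V) : Prop :=
  forall v i (a : R) x y,
    w (subst_at v i (a *: x + y)) =
    a *: w (subst_at v i x) + w (subst_at v i y).

Definition alternating (w : ('I_k -> E) -> V) : Prop :=
  forall v i j, i != j -> v i = v j -> w v = 0.

Definition symmetric (w : ('I_k -> E) -> V) : Prop :=
  forall v (s : {perm 'I_k}), w (v \o s) = w v.
End Multilinear.

Section Weil.
Variables (E : lmodType R) (p q : nat).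
Definition weil_fun := ('I_(p - q) -> E) -> ('I_q -> E) -> R.
(* W^{p,q} = Alt^(p-q) (x) Sym^q of the dual of E, realized as multilinear maps
   alternating in the first p - q and symmetric in the last q arguments. *)
Definition weil_space : set weil_fun :=
  if (q <= p)%N then
    [set c | (forall u, multilinear (c u) /\ symmetric (c u)) /\
             (forall w, multilinear (c^~ w) /\ alternating (c^~ w))]
  else [set c | forall u w, c u w = 0].
Definition weil_pred : {pred weil_fun} := fun c => `[< weil_space c >].
Record weil := Weil { weil_val : weil_fun; weilP : weil_val \in weil_pred }.
HB.instance Definition _ := [isSub for weil_val].
HB.instance Definition _ := [Choice of weil by <:].
Lemma weil_zmod : zmod_closed weil_pred.
Proof.
split.
  apply/asboolP; rewrite /weil_space; case: ifP => // _.
  by split=> u; split=> // v i a x y; apply: (esym (etrans (addr0 _) (scaler0 _ _))).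
move=> c d /asboolP cW /asboolP dW; apply/asboolP; move: cW dW.
rewrite /weil_space; case: ifP => _ => [[c1 c2] [d1 d2]|c0 d0 u w]; last first.
  by rewrite !fctE c0 d0 subrr.
split=> u; split.
- by move=> v i a x y; rewrite !fctE (c1 u).1 (d1 u).1 scalerBr opprD addrACA.
- by move=> v s; rewrite !fctE (c1 u).2 (d1 u).2.
- move=> v i a x y; have := (c2 u).1 v i a x y; have := (d2 u).1 v i a x y.
  by rewrite !fctE => -> ->; rewrite scalerBr opprD addrACA.
- move=> v i j ij vij; have := (c2 u).2 v i j ij vij; have := (d2 u).2 v i j ij vij.
  by rewrite !fctE => -> ->; rewrite subrr.
Qed.
HB.instance Definition _ := GRing.isZmodClosed.Build weil_fun weil_pred weil_zmod.
HB.instance Definition _ := [SubChoice_isSubZmodule of weil by <:].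
End Weil.

Section Forms.
Variables (E : normedModType R) (M : manifold E).

(* Alternation, multilinearity and smoothness are imposed by is_form below. *)
Definition form (V : Type) (k : nat) := M -> ('I_k -> E) -> V.

Definition vector_field := M -> E.

(* The tangent vector at cinv c y whose coordinates in the chart c are u. *)
Definition chart_diff (c : chart M E) (y : E) : {linear E -> E} :=
  'd (cmap (chart_at (cinv c y)) \o cinv c) y.

(* The coefficients of w in every chart are smooth. *)
Definition smooth_form (k : nat) (w : form R k) : Prop :=
  forall c, atlas c -> forall v : 'I_k -> E,
    smooth_on (cimg c) (fun y : E => w (cinv c y) (chart_diff c y \o v)).

Definition is_form (k : nat) (w : form R k) : Prop :=
  [/\ forall x, multilinear (w x), forall x, alternating (w x) & smooth_form w].

Definition vcons (k : nat) (x : E) (v : 'I_k -> E) : 'I_k.+1 -> E :=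
  fun i => if unlift ord0 i is Some j then v j else x.

Definition contract (V : Type) (k : nat) (X : vector_field)
    (w : form V k.+1) : form V k :=
  fun x v => w x (vcons (X x) v).

(* Coordinate expression of X in the chart c. *)
Definition vf_rep (c : chart M E) (X : vector_field) : E -> E :=
  fun y => 'd (cmap c \o cinv (chart_at (cinv c y)))
             (cmap (chart_at (cinv c y)) (cinv c y)) (X (cinv c y)).

Definition vf_bracket (X Y : vector_field) : vector_field := fun x =>
  let c := chart_at x in
  'd (vf_rep c Y) (cmap c x) (vf_rep c X (cmap c x)) -
  'd (vf_rep c X) (cmap c x) (vf_rep c Y (cmap c x)).
End Forms.

Definition pullback (E F : normedModType R) (M : manifold E) (N : manifold F)
    (V : Type) (k : nat) (f : M -> N) (w : form N V k) : form M V k :=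
  fun x v => w (f x) (tangent_map f x \o v).

Section Wedge.
Variables (E : normedModType R) (M : manifold E) (V1 V2 : Type).
Variables (V : lmodType R) (B : V1 -> V2 -> V).

(* The product of a 1-form and a k-form along B, with the normalization
   <a, b>(v, w) = B (a v) (b w) - B (a w) (b v) for k = 1. In particular
   [theta, theta](v, w) = 2 [theta v, theta w]. *)
Definition wedge1 (k : nat) (a : form M V1 1) (b : form M V2 k) :
    form M V k.+1 :=
  fun x v => \sum_(i < k.+1) (-1) ^+ i *: B (a x (fun=> v i)) (b x (v \o lift i)).
End Wedge.


Section FormTheory.
Variables (E F : normedModType R) (M : manifold E) (N : manifold F).

Lemma pullback_multilinear (V : lmodType R) k (f : M -> N) (w : form N V k) :
  (forall x, multilinear (w x)) -> forall x, multilinear (pullback f w x).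
Proof.
move=> lw x v i a y z; rewrite /pullback.
have e t : tangent_map f x \o subst_at v i t =
    subst_at (tangent_map f x \o v) i (tangent_map f x t).
  by apply: funext => j /=; rewrite /subst_at; case: (j == i).
by rewrite !e linearP lw.
Qed.

Lemma wedge1_multilinear (V1 V2 V : lmodType R) (B : V1 -> V2 -> V) k
    (a : form M V1 1) (b : form M V2 k) :
  (forall u, linear (B u)) -> (forall w, linear (B^~ w)) ->
  (forall x, multilinear (a x)) -> (forall x, multilinear (b x)) ->
  forall x, multilinear (wedge1 B a b x).
Proof.
move=> Br Bl la lb x v j c y z; rewrite /wedge1 scaler_sumr -big_split.
apply: eq_bigr => i _ /=; rewrite scalerA mulrC -scalerA -scalerDr; congr (_ *: _).
have [<-|ij] := eqVneq i j.
  have eb t : subst_at v i t \o lift i = v \o lift i.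
    by apply: funext => l /=; rewrite /subst_at eq_sym (negbTE (neq_lift _ _)).
  have la1 : a x (fun=> c *: y + z) = c *: a x (fun=> y) + a x (fun=> z).
    have e t : subst_at (fun=> (0 : E)) (ord0 : 'I_1) t = (fun=> t).
      by apply: funext => l; rewrite /subst_at ord1 eqxx.
    by have := la x (fun=> 0) ord0 c y z; rewrite !e.
  have ea t : (fun=> subst_at v i t i) = (fun=> t) :> ('I_1 -> E).
    by apply: funext => l; rewrite /subst_at eqxx.
  by rewrite !eb !ea la1; apply: (Bl _ c).
have ea t : (fun=> subst_at v j t i) = (fun=> v i) :> ('I_1 -> E).
  by apply: funext => l; rewrite /subst_at (negbTE ij).
have [l jl] : exists l, j = lift i l by case: (unliftP i j) ij => [l ->|->]; [exists l|rewrite eqxx].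
have eb t : subst_at v j t \o lift i = subst_at (v \o lift i) l t.
  by apply: funext => m /=; rewrite /subst_at jl (inj_eq lift_inj).
by rewrite !ea !eb lb Br.
Qed.
End FormTheory.

Record lieGroup (n : nat) := LieGroup {
  lg_manifold :> manifold 'rV[R]_n;
  lg_hausdorff : hausdorff_space lg_manifold;
  lg_second_countable : @second_countable lg_manifold;
  lg_one : lg_manifold;
  lg_mul : lg_manifold -> lg_manifold -> lg_manifold;
  lg_inv : lg_manifold -> lg_manifold;
  lg_mulA : associative lg_mul;
  lg_mul1g : left_id lg_one lg_mul;
  lg_mulg1 : right_id lg_one lg_mul;
  lg_mulVg : left_inverse lg_one lg_inv lg_mul;
  lg_mulgV : right_inverse lg_one lg_inv lg_mul;
  lg_mul_smooth :
    smooth_map (M := prod_manifold lg_manifold lg_manifold) (N := lg_manifold)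
      (fun p => lg_mul p.1 p.2);
  lg_inv_smooth : smooth_map (M := lg_manifold) (N := lg_manifold) lg_inv
}.

Section LieGroup.
Variables (n : nat) (G : lieGroup n).
Local Notation E := 'rV[R]_n.

Definition left_vf (v : E) : vector_field G :=
  fun g => tangent_map (M := G) (N := G) (fun x => lg_mul g x) (lg_one G) v.

Definition lie_bracket (u v : E) : E :=
  vf_bracket (left_vf u) (left_vf v) (lg_one G).

Definition mc_left : form G E 1 := fun g v =>
  tangent_map (M := G) (N := G) (fun x => lg_mul (lg_inv g) x) g (v ord0).
Definition mc_right : form G E 1 := fun g v =>
  tangent_map (M := G) (N := G) (fun x => lg_mul x (lg_inv g)) g (v ord0).

Record quadratic_structure := QuadraticStructure {
  qpair :> E -> E -> R;
  qpair_linear : forall u (a : R) v w, qpair u (a *: v + w) = a * qpair u v + qpair u w;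
  qpair_sym : forall u v, qpair u v = qpair v u;
  qpair_nondeg : forall u, (forall v, qpair u v = 0) -> u = 0;
  qpair_ad : forall u v w, qpair (lie_bracket u v) w = qpair u (lie_bracket v w)
}.

(* 'rV_0 is the one-point space. *)
Definition nerve0 : manifold 'rV[R]_0 := vect_manifold 'rV[R]_0.
Definition nerve1 : manifold E := G.
Definition nerve2 : manifold (E * E)%type := prod_manifold G G.

Definition face0 (p : nerve2) : nerve1 := p.2.
Definition face2 (p : nerve2) : nerve1 := p.1.
Definition degen00 (_ : nerve0) : nerve1 := lg_one G.
Definition degen10 (g : nerve1) : nerve2 := (lg_one G, g).
Definition degen11 (g : nerve1) : nerve2 := (g, lg_one G).

(* Families in Omega^2(NG_2) + Omega^3(NG_1) + Omega^4(NG_0). *)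
Record shifted_form := ShiftedForm {
  sform2 : form nerve2 R 2;
  sform1 : form nerve1 R 3;
  sform0 : form nerve0 R 4
}.

Record normalized (w : shifted_form) : Prop := {
  sform2_form : is_form (sform2 w);
  sform1_form : is_form (sform1 w);
  sform0_form : is_form (sform0 w);
  pull_degen10 : pullback (M := nerve1) degen10 (sform2 w) = 0;
  pull_degen11 : pullback (M := nerve1) degen11 (sform2 w) = 0;
  pull_degen00 : pullback (M := nerve0) degen00 (sform1 w) = 0
}.

Record normalized_form := NormalizedForm {
  nform :> shifted_form;
  nformP : normalized nform
}.

Definition left_vf2 (w : E) : vector_field nerve2 :=
  fun p => (left_vf w p.1, 0).

(* - s_0^* i_{v^} s_0^* i_{w^} b, a 0-form on the point, evaluated there. *)
Definition ve22 (b : form nerve2 R 2) (v w : E) : R :=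
  - pullback (M := nerve0) degen00
      (contract (left_vf v)
        (pullback (M := nerve1) degen10 (contract (left_vf2 w) b)))
      0 (fun=> 0).

(* Omega = <d_2^* theta^l, d_0^* theta^r>, Theta = 1/6 <theta^l, [theta^l, theta^l]>. *)
Definition Omega (Q : quadratic_structure) : form nerve2 R 2 :=
  wedge1 Q (pullback face2 mc_left) (pullback face0 mc_right).
Definition Theta (Q : quadratic_structure) : form nerve1 R 3 :=
  6^-1 *: wedge1 Q mc_left (wedge1 lie_bracket mc_left mc_left).

Local Notation e1 := (lg_one G).
Local Notation GG := (prod_manifold G G).

Section MaurerCartan.
Variable h : GG -> G.
Hypothesis sh : smooth_map (M := GG) (N := G) h.
Hypothesis hV : forall g, h (g, g) = e1.

Definition mc_of : form G E 1 := fun g v =>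
  tangent_map (M := G) (N := G) (fun x => h (g, x)) g (v ord0).

Lemma mc_of_chart (c : chart G E) y u : atlas c -> cimg c y ->
  mc_of (cinv c y) (fun=> chart_diff c y u) =
  'd (cmap (chart_at e1) \o h \o cinv (prod_chart c c)) (y, y) (0, u).
Proof.
move=> ac cy; set x := cinv c y.
have shx := smooth_map_slice x sh.
rewrite -[LHS]/((tangent_map (M := G) (N := G) (fun z => h (x, z)) x \o
   'd (cmap (chart_at x) \o cinv c) y) u) -(tangent_map_chart shx ac cy) hV.
have [cx _] := cimgP cy.
have dP : differentiable (cmap (chart_at e1) \o h \o cinv (prod_chart c c)) (y, y).
  apply: (@differentiable_chart _ _ _ GG G h (prod_chart c c) (chart_at e1) (y, y) sh).
  - by exists c, c.
  - exact: atlas_chart_at.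
  - by rewrite /cimg prod_cimg.
  - by rewrite /= hV; exact: mem_chart_at.
by rewrite -[RHS]/((fun u => 'd _ (y, y) (0, u)) u) -(diff_partial dP).
Qed.

Lemma Ck_mc_of (c : chart G E) k : atlas c ->
  Ck k (cimg c `*` [set: E])
    (fun q : E * E => mc_of (cinv c q.1) (fun=> chart_diff c q.1 q.2)).
Proof.
move=> ac; set e := chart_at e1.
pose P := cmap e \o h \o cinv (prod_chart c c).
have acc : atlas (m := GG) (prod_chart c c) by exists c, c.
have ae : atlas e := atlas_chart_at e1.
have [ch _] := sh.
have oW := open_chart_preimg (M := GG) (prod_chart c c) e ch.
set W := (X in open X) in oW.
have PC : Ck k (W `*` setT) (fun q => 'd P (q.1) q.2).
  by have [_] := (sh).2 _ _ acc ae k.+1.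
have oU : open (cimg c `*` [set: E]).
  by apply: open_setX; [exact: cimg_open|exact: openT].
apply: (@Ck_ext _ _ _ _ _ (fun q : E * E => 'd P ((q.1, q.1)) (0, q.2))) => //.
  by move=> [y u]; rewrite inE => -[/= cy _]; rewrite mc_of_chart.
apply: (@Ck_comp2 _ _ _ _ _ _ _ (W `*` setT) (fun q : E * E => (q.1, q.1))
   (fun q => (0, q.2)) (fun q => 'd P (q.1) q.2)) => //.
- by apply: open_setX => //; exact: openT.
- move=> [y u] [/= [x cx <-] _]; split=> //=.
  by exists (x, x) => //; split=> //=; rewrite hV; exact: mem_chart_at.
- by apply: Ck_pair => //; exact: Ck_fst.
- by apply: Ck_pair => //; [exact: Ck_cst|exact: Ck_snd].
Qed.
End MaurerCartan.

Lemma smooth_invmul :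
  smooth_map (M := GG) (N := G) (fun p => lg_mul (lg_inv p.1) p.2).
Proof.
apply: (@smooth_map_comp _ _ _ _ GG GG G (fun p => (lg_inv p.1, p.2))
  (fun p => lg_mul p.1 p.2)); last exact: lg_mul_smooth.
apply: smooth_map_pair; last exact: smooth_map_snd.
apply: (@smooth_map_comp _ _ _ _ GG G G fst (@lg_inv n G)).
  exact: smooth_map_fst.
exact: lg_inv_smooth.
Qed.

Lemma smooth_mulinv :
  smooth_map (M := GG) (N := G) (fun p => lg_mul p.2 (lg_inv p.1)).
Proof.
apply: (@smooth_map_comp _ _ _ _ GG GG G (fun p => (p.2, lg_inv p.1))
  (fun p => lg_mul p.1 p.2)); last exact: lg_mul_smooth.
apply: smooth_map_pair; first exact: smooth_map_snd.
apply: (@smooth_map_comp _ _ _ _ GG G G fst (@lg_inv n G)).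
  exact: smooth_map_fst.
exact: lg_inv_smooth.
Qed.

Lemma mc_left_of : mc_left = mc_of (fun p => lg_mul (lg_inv p.1) p.2).
Proof. by []. Qed.

Lemma mc_right_of : mc_right = mc_of (fun p => lg_mul p.2 (lg_inv p.1)).
Proof. by []. Qed.

Lemma Ck_mc_left (c : chart G E) k : atlas c -> Ck k (cimg c `*` [set: E])
  (fun q : E * E => mc_left (cinv c q.1) (fun=> chart_diff c q.1 q.2)).
Proof. exact: (Ck_mc_of smooth_invmul (@lg_mulVg n G)). Qed.

Lemma Ck_mc_right (c : chart G E) k : atlas c -> Ck k (cimg c `*` [set: E])
  (fun q : E * E => mc_right (cinv c q.1) (fun=> chart_diff c q.1 q.2)).
Proof. exact: (Ck_mc_of smooth_mulinv (@lg_mulgV n G)). Qed.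

Lemma smooth_lmul g : smooth_map (M := G) (N := G) (lg_mul g).
Proof. exact: (smooth_map_slice g (@lg_mul_smooth n G)). Qed.

Lemma vf_rep_left (c : chart G E) v y : atlas c -> cimg c y ->
  vf_rep c (left_vf v) y =
  'd (cmap c \o (fun p : GG => lg_mul p.1 p.2) \o
      cinv (prod_chart c (chart_at e1))) (y, cmap (chart_at e1) e1) (0, v).
Proof.
move=> ac cy; set q := cinv c y; set d := chart_at e1.
have [cq _] := cimgP cy; have d1 : cdom d e1 := mem_chart_at e1.
have cq1 : cdom c (lg_mul q e1) by rewrite lg_mulg1.
have := chart_tangent_map (smooth_lmul q) ac cq1.
rewrite lg_mulg1 => /(congr1 (fun f => f v)) /= H.
rewrite -[LHS]H.
have dP : differentiable (cmap c \o (fun p : GG => lg_mul p.1 p.2) \o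
    cinv (prod_chart c d)) (y, cmap d e1).
  apply: (@differentiable_chart _ _ _ GG G _ (prod_chart c d) c (y, cmap d e1) (@lg_mul_smooth n G)).
  - by exists c, d; split=> //; exact: atlas_chart_at.
  - by [].
  - by rewrite /cimg prod_cimg; split=> //; exists e1.
  - by rewrite /= cmapK.
by rewrite -[RHS]/((fun u => 'd _ (y, cmap d e1) (0, u)) v) -(diff_partial dP).
Qed.

Lemma smooth_vf_rep_left (c : chart G E) v : atlas c ->
  smooth_on (cimg c) (vf_rep c (left_vf v)).
Proof.
move=> ac k; set d := chart_at e1.
pose m := fun p : GG => lg_mul p.1 p.2.
pose P := cmap c \o m \o cinv (prod_chart c d).
have [cm sm] : smooth_map (M := GG) (N := G) m := @lg_mul_smooth n G.
have ad : atlas d := atlas_chart_at e1.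
have d1 : cdom d e1 := mem_chart_at e1.
have acd : atlas (m := GG) (prod_chart c d) by exists c, d.
have oW := open_chart_preimg (M := GG) (prod_chart c d) c cm.
set W := (X in open X) in oW.
have PC : Ck k (W `*` setT) (fun q => 'd P (q.1) q.2).
  by have [_] := sm _ _ acd ac k.+1.
apply: (@Ck_ext _ _ _ _ _ (fun y => 'd P ((y, cmap d e1)) (0, v))).
- exact: cimg_open.
- by move=> y; rewrite inE => cy; rewrite vf_rep_left.
apply: (@Ck_comp2 _ _ _ _ _ _ _ (W `*` setT) (fun y => (y, cmap d e1))
   (fun=> (0, v)) (fun q => 'd P (q.1) q.2)) => //.
- exact: cimg_open.
- by apply: open_setX => //; exact: openT.
- move=> _ [x cx <-]; split=> //=.
  by exists (x, e1) => //; split=> //; rewrite /m /= lg_mulg1.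
- apply: Ck_pair; [exact: cimg_open| |exact: Ck_cst].
  exact: (@Ck_lin _ _ _ _ _ idfun (fun=> cvg_id)).
- exact: Ck_cst.
Qed.

Lemma left_vf_linear g : linear (fun v => left_vf v g).
Proof. by move=> a u v; exact: linearP. Qed.

Lemma vf_rep_left_linear c a u v :
  vf_rep c (left_vf (a *: u + v)) =
  a *: vf_rep c (left_vf u) + vf_rep c (left_vf v).
Proof.
apply: funext => y; rewrite /vf_rep left_vf_linear.
exact: linearP.
Qed.

Lemma lie_bracket_linear u : linear (lie_bracket u).
Proof.
move=> a v w; rewrite /lie_bracket /vf_bracket.
set c := chart_at e1.
have ac : atlas c := atlas_chart_at e1.
have cy : cimg c (cmap c e1) by apply: cimg_cmap; exact: mem_chart_at.
have df v' : differentiable (vf_rep c (left_vf v')) (cmap c e1).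
  exact: (smooth_on_differentiable (smooth_vf_rep_left v' ac) cy).
rewrite vf_rep_left_linear.
set y := cmap c e1; set U := vf_rep c (left_vf u).
set V := vf_rep c (left_vf v); set W := vf_rep c (left_vf w).
have D := @diff_lincomb _ _ _ V W a y (U y) (df v) (df w).
have L : 'd U y ((a *: V + W) y) = a *: 'd U y (V y) + 'd U y (W y).
  exact: linearP.
have A (x1 x2 x3 x4 : E) :
    (a *: x1 + x2) - (a *: x3 + x4) = a *: (x1 - x3) + (x2 - x4).
  by rewrite opprD addrACA scalerBr.
exact: (etrans (f_equal2 (fun z t => z - t) D L) (A _ _ _ _)).
Qed.

Lemma lie_bracketC u v : lie_bracket v u = - lie_bracket u v.
Proof. by rewrite /lie_bracket /vf_bracket opprB. Qed.

Lemma lie_bracket_linearl v : linear (lie_bracket^~ v).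
Proof.
by move=> a u w; rewrite lie_bracketC lie_bracket_linear opprD -scalerN -!(lie_bracketC v).
Qed.

Lemma mc_left_multilinear x : multilinear (mc_left x).
Proof. by move=> v i a y z; rewrite /mc_left /subst_at (ord1 i) eqxx linearP. Qed.

Lemma mc_right_multilinear x : multilinear (mc_right x).
Proof. by move=> v i a y z; rewrite /mc_right /subst_at (ord1 i) eqxx linearP. Qed.

Section CanonicalForms.
Variable Q : quadratic_structure.

Lemma qpair_linearr u : linear (Q u).
Proof. by move=> a v w; exact: qpair_linear. Qed.

Lemma qpair_linearl w : linear (Q^~ w).
Proof.
by move=> a u v; rewrite (qpair_sym Q) qpair_linear !(qpair_sym Q w).
Qed.

Lemma Omega_multilinear p : multilinear (Omega Q p).
Proof.
apply: wedge1_multilinear; [exact: qpair_linearr|exact: qpair_linearl|..].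
  by apply: pullback_multilinear => x; (exact: mc_left_multilinear || exact: mc_right_multilinear).
by apply: pullback_multilinear => x; (exact: mc_left_multilinear || exact: mc_right_multilinear).
Qed.

Lemma Theta_multilinear g : multilinear (Theta Q g).
Proof.
move=> v i a x y; rewrite /Theta !fctE.
rewrite (@wedge1_multilinear _ _ _ _ _ Q _ mc_left) //.
- by rewrite scalerDr !scalerA mulrC.
- exact: qpair_linearr.
- exact: qpair_linearl.
- (exact: mc_left_multilinear || exact: mc_right_multilinear).
- apply: wedge1_multilinear; [exact: lie_bracket_linear|exact: lie_bracket_linearl|..];
  (exact: mc_left_multilinear || exact: mc_right_multilinear).
Qed.

Lemma Omega_alternating p : alternating (Omega Q p).
Proof.
suff H v : v ord0 = v ord_max -> Omega Q p v = 0.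
  move=> v i j ij vij; apply: H; move: ij vij.
  by case: i j => [[|[|//]] i] [[|[|//]] j] // _ vij;
    [move: vij|move: (esym vij)]; congr (v _ = v _); apply: val_inj.
move=> v01; rewrite /Omega /wedge1 !big_ord_recl big_ord0 /= addr0 expr0 expr1.
rewrite scale1r scaleN1r /pullback /mc_left /mc_right /=.
rewrite (_ : lift ord0 ord0 = ord_max); last exact: val_inj.
rewrite (_ : lift ord_max ord0 = ord0); last exact: val_inj.
by rewrite v01 subrr.
Qed.

Lemma Theta_alternating g : alternating (Theta Q g).
Proof.
pose t (v : 'I_3 -> E) i := mc_left g (fun=> v i).
have QD u x y : Q u (x + y) = Q u x + Q u y.
  by have := qpair_linearr u 1 x y; rewrite !scale1r.
have QN u x : Q u (- x) = - Q u x.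
  by have := qpair_linearr u (-1) x 0; rewrite addr0 scaleN1r => ->;
    rewrite scaleN1r -[Q u 0](addrK (Q u 0)) -QD addr0 subrr addr0.
pose b (u w : E) : E := lie_bracket u w - lie_bracket w u.
have bC u w : b w u = - b u w by exact: (esym (opprB _ _)).
have bb u : b u u = 0 by exact: subrr.
have Q0 u : Q u 0 = 0 by rewrite -[0 in LHS](subrr u) QD QN subrr.
pose i0 : 'I_3 := ord0; pose i1 : 'I_3 := lift ord0 ord0.
pose i2 : 'I_3 := lift ord0 (lift ord0 ord0).
have TE v : Theta Q g v = (6^-1 : R) * (Q (t v i0) (b (t v i1) (t v i2)) -
    Q (t v i1) (b (t v i0) (t v i2)) + Q (t v i2) (b (t v i0) (t v i1))) :> R.
  rewrite /Theta !fctE /wedge1 !big_ord_recl !big_ord0 /= !addr0 !expr0 !expr1.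
  rewrite !scale1r !scaleN1r expr2 mulrNN mulr1 scale1r addrA.
  have e0 : lift i1 (ord0 : 'I_2) = i0 by apply: val_inj.
  have e1' : lift i1 (lift ord0 ord0 : 'I_2) = i2 by apply: val_inj.
  have e2 : lift i2 (ord0 : 'I_2) = i0 by apply: val_inj.
  have e3 : lift i2 (lift ord0 ord0 : 'I_2) = i1 by apply: val_inj.
  have e4 : lift (lift ord0 ord0 : 'I_2) (ord0 : 'I_1) = ord0 by apply: val_inj.
  by rewrite /mc_left /= !e4 e0 e1' e2 e3.
have H01 v : v i0 = v i1 -> Theta Q g v = 0.
  by move=> h; rewrite TE /t h bb Q0 subrr addr0 mulr0.
have H02 v : v i0 = v i2 -> Theta Q g v = 0.
  move=> h; rewrite TE /t h bb Q0 subr0 -/(t v i1) -/(t v i2).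
  by rewrite (bC (t v i1)) QN subrr mulr0.
have H12 v : v i1 = v i2 -> Theta Q g v = 0.
  by move=> h; rewrite TE /t h bb Q0 sub0r addNr mulr0.
have I3 (k : 'I_3) : [\/ k = i0, k = i1 | k = i2].
  case: k => [[|[|[|//]]] ?]; [apply: Or31|apply: Or32|apply: Or33]; exact: val_inj.
move=> v i j; case: (I3 i) (I3 j) => -> [] -> //; rewrite ?eqxx // => _ h.
- exact: H01.
- exact: H02.
- exact: (H01 _ (esym h)).
- exact: H12.
- exact: (H02 _ (esym h)).
- exact: (H12 _ (esym h)).
Qed.

Lemma Omega_smooth : smooth_form (Omega Q).
Proof.
move=> _ [c [d [ac ad ->]]] v k; set cd := prod_chart c d.
have acd : atlas (m := GG) cd by exists c, d.
have cimgE : cimg cd = cimg c `*` cimg d by rewrite /cimg prod_cimg.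
have oU : open (cimg cd) := cimg_open cd.
pose lft (y u : E * E) := mc_left (cinv c y.1) (fun=> chart_diff c y.1 u.1).
pose rgt (y u : E * E) := mc_right (cinv d y.2) (fun=> chart_diff d y.2 u.2).
have lE y u : cimg cd y ->
    pullback (M := GG) face2 mc_left (cinv cd y) (fun=> chart_diff (M := GG) cd y u) = lft y u.
  move=> cy; rewrite /pullback /mc_left; congr (tangent_map _ _ _).
  have H := tangent_map_chart (M := GG) (N := G) (@smooth_map_fst _ _ _ G G) acd cy.
  apply: (etrans (esym (congr1 (fun w : E * E -> E => w u) H))).
  move: cy; rewrite cimgE => -[cy1 cy2].
  have dc : differentiable (cmap (chart_at (cinv c y.1)) \o cinv c) (fst y).
    apply: (smooth_on_differentiable (atlas_compatible ac (atlas_chart_at _))).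
    by rewrite cimg_pre; split=> //; exact: mem_chart_at.
  have D := diff_comp (@differentiable_fst _ E E y) dc.
  apply: (etrans (congr1 (fun w : E * E -> E => w u) D)) => /=.
  by rewrite diff_fst.
have rE y u : cimg cd y ->
    pullback (M := GG) face0 mc_right (cinv cd y) (fun=> chart_diff (M := GG) cd y u) = rgt y u.
  move=> cy; rewrite /pullback /mc_right; congr (tangent_map _ _ _).
  have H := tangent_map_chart (M := GG) (N := G) (@smooth_map_snd _ _ _ G G) acd cy.
  apply: (etrans (esym (congr1 (fun w : E * E -> E => w u) H))).
  move: cy; rewrite cimgE => -[cy1 cy2].
  have dc : differentiable (cmap (chart_at (cinv d y.2)) \o cinv d) (snd y).
    apply: (smooth_on_differentiable (atlas_compatible ad (atlas_chart_at _))).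
    by rewrite cimg_pre; split=> //; exact: mem_chart_at.
  have D := diff_comp (@differentiable_snd _ E E y) dc.
  apply: (etrans (congr1 (fun w : E * E -> E => w u) D)) => /=.
  by rewrite diff_snd.
apply: (@Ck_ext _ _ _ _ _ (fun y => \sum_(i < 2) (-1) ^+ i *:
   (Q (lft y (v i)) (rgt y (v (lift i ord0))) : R))) => //.
  move=> y; rewrite inE => cy; apply: eq_bigr => i _; congr (_ *: Q _ _).
    by rewrite -lE.
  by rewrite -rE.
apply: Ck_sum => // i; apply: Ck_scaler => //.
apply: Ck_bilin => //; [exact: qpair_linearr|exact: qpair_linearl|..].
- apply: (@Ck_comp2 _ _ _ _ _ _ _ (cimg c `*` setT) (fun y : E * E => y.1) (fun=> (v i).1)
    (fun q : E * E => mc_left (cinv c q.1) (fun=> chart_diff c q.1 q.2))) => //.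
  + by apply: open_setX; [exact: cimg_open|exact: openT].
  + by move=> y; rewrite cimgE => -[].
  + exact: Ck_fst.
  + exact: Ck_cst.
  + exact: Ck_mc_left.
- apply: (@Ck_comp2 _ _ _ _ _ _ _ (cimg d `*` setT) (fun y : E * E => y.2) (fun=> (v (lift i ord0)).2)
    (fun q : E * E => mc_right (cinv d q.1) (fun=> chart_diff d q.1 q.2))) => //.
  + by apply: open_setX; [exact: cimg_open|exact: openT].
  + by move=> y; rewrite cimgE => -[].
  + exact: Ck_snd.
  + exact: Ck_cst.
  + exact: Ck_mc_right.
Qed.

Lemma Theta_smooth : smooth_form (Theta Q).
Proof.
move=> c ac v k.
have oU : open (cimg c) := cimg_open c.
have Cl (u : E) : Ck k (cimg c) (fun y => mc_left (cinv c y) (fun=> chart_diff c y u)).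
  apply: (@Ck_comp2 _ _ _ _ _ _ _ (cimg c `*` setT) id (fun=> u)
    (fun q : E * E => mc_left (cinv c q.1) (fun=> chart_diff c q.1 q.2))) => //.
  - by apply: open_setX => //; exact: openT.
  - exact: (@Ck_lin _ _ _ _ _ idfun (fun=> cvg_id)).
  - exact: Ck_cst.
  - exact: Ck_mc_left.
pose b y i j := lie_bracket
  (mc_left (cinv c y) (fun=> chart_diff c y (v (lift i j))))
  (mc_left (cinv c y) (fun=> chart_diff c y (v (lift i (lift j (ord0 : 'I_1)))))).
apply: (@Ck_ext _ _ _ _ _ (fun y => 6^-1 *: (\sum_(i < 3) (-1) ^+ i *:
   (Q (mc_left (cinv c y) (fun=> chart_diff c y (v i)))
      (\sum_(j < 2) (-1) ^+ j *: b y i j) : R)) : R)) => //.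
apply: Ck_scaler => //; apply: Ck_sum => // i; apply: Ck_scaler => //.
apply: Ck_bilin => //; [exact: qpair_linearr|exact: qpair_linearl|].
apply: Ck_sum => // j; apply: Ck_scaler => //.
by apply: Ck_bilin => //; [exact: lie_bracket_linear|exact: lie_bracket_linearl].
Qed.
End CanonicalForms.

Lemma smooth_degen10 : smooth_map (M := G) (N := GG) degen10.
Proof. by apply: smooth_map_pair; [exact: smooth_map_cst|exact: smooth_map_id]. Qed.

Lemma smooth_degen11 : smooth_map (M := G) (N := GG) degen11.
Proof. by apply: smooth_map_pair; [exact: smooth_map_id|exact: smooth_map_cst]. Qed.

Lemma tangent_degen10 g u :
  tangent_map (M := G) (N := GG) degen10 g u = (0, u).
Proof.
have sd := smooth_degen10; apply: injective_projections.
  have C := @tangent_map_comp _ _ _ _ G GG G _ _ g sd (@smooth_map_fst _ _ _ G G).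
  have := congr1 (fun w : E -> E => w u) C.
  rewrite (tangent_map_cst (M := G) (N := G) e1) /= (tangent_map_fst (N := G) (P := G)).
  by move=> <-.
have C := @tangent_map_comp _ _ _ _ G GG G _ _ g sd (@smooth_map_snd _ _ _ G G).
have := congr1 (fun w : E -> E => w u) C.
rewrite (tangent_map_id (M := G)) /= (tangent_map_snd (N := G) (P := G)).
by move=> <-.
Qed.

Lemma tangent_degen11_snd g u :
  (tangent_map (M := G) (N := GG) degen11 g u).2 = 0.
Proof.
have sd := smooth_degen11.
have C := @tangent_map_comp _ _ _ _ G GG G _ _ g sd (@smooth_map_snd _ _ _ G G).
have := congr1 (fun w : E -> E => w u) C.
rewrite (tangent_map_cst (M := G) (N := G) e1) /= (tangent_map_snd (N := G) (P := G)).
by move=> <-.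
Qed.

Definition Omega_shifted Q := ShiftedForm (Omega Q) (- Theta Q) 0.

Lemma is_form0 (F : normedModType R) (M : manifold F) k : is_form (0 : form M R k).
Proof.
split=> [x v i a y z|x v i j|c ac v l]; rewrite ?scaler0 ?addr0 //.
exact: Ck_cst.
Qed.

Lemma is_formN (F : normedModType R) (M : manifold F) k (w : form M R k) :
  is_form w -> is_form (- w).
Proof.
move=> [lw aw sw]; split=> [x v i a y z|x v i j ij vij|c ac v l].
- by rewrite !fctE lw opprD scalerN.
- by rewrite !fctE (aw x v i j ij vij) oppr0.
- apply: (@Ck_ext _ _ _ _ _ (fun y => -1 *: (w (cinv c y) (chart_diff c y \o v) : R))).
  + exact: cimg_open.
  + by move=> y _; rewrite scaleN1r.
  + by apply: Ck_scaler; [exact: cimg_open|exact: sw].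
Qed.

Lemma mc_left0 g (v : 'I_1 -> E) : v ord0 = 0 -> mc_left g v = 0.
Proof. by move=> v0; rewrite /mc_left v0; exact: linear0. Qed.

Lemma mc_right0 g (v : 'I_1 -> E) : v ord0 = 0 -> mc_right g v = 0.
Proof. by move=> v0; rewrite /mc_right v0; exact: linear0. Qed.

Lemma tangent_face2 (p : GG) w :
  tangent_map (M := GG) (N := G) face2 p w = w.1.
Proof. exact: (congr1 (fun f : E * E -> E => f w) (@tangent_map_fst _ _ _ G G p)). Qed.

Lemma tangent_face0 (p : GG) w :
  tangent_map (M := GG) (N := G) face0 p w = w.2.
Proof. exact: (congr1 (fun f : E * E -> E => f w) (@tangent_map_snd _ _ _ G G p)). Qed.

Lemma Omega_shifted_normalized Q : normalized (Omega_shifted Q).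
Proof.
have Q0l u : Q 0 u = 0.
  have := qpair_linearl Q u (-1) 0 0; rewrite scaler0 addr0 scaleN1r => H.
  by rewrite H addNr.
have Q0r u : Q u 0 = 0 by rewrite qpair_sym.
split=> /=.
- by split; [exact: Omega_multilinear|exact: Omega_alternating|exact: Omega_smooth].
- apply: is_formN.
  by split; [exact: Theta_multilinear|exact: Theta_alternating|exact: Theta_smooth].
- exact: is_form0.
- apply: funext => g; apply: funext => v.
  rewrite /pullback /Omega /wedge1 big1 // => i _.
  have z : pullback (M := GG) face2 mc_left (degen10 g)
      (fun=> (tangent_map (M := G) (N := GG) degen10 g \o v) i) = 0.
    apply: mc_left0; apply: (etrans (tangent_face2 _ _)).
    exact: (congr1 fst (tangent_degen10 g (v i))).
  by rewrite z Q0l scaler0.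
- apply: funext => g; apply: funext => v.
  rewrite /pullback /Omega /wedge1 big1 // => i _.
  have z : pullback (M := GG) face0 mc_right (degen11 g)
      ((tangent_map (M := G) (N := GG) degen11 g \o v) \o lift i) = 0.
    apply: mc_right0; apply: (etrans (tangent_face0 _ _)).
    exact: tangent_degen11_snd.
  by rewrite z Q0r scaler0.
- apply: funext => x; apply: funext => v.
  have z i : mc_left e1
      (fun=> (tangent_map (M := nerve0) (N := G) degen00 x \o v) i) = 0.
    apply: mc_left0.
    exact: (congr1 (fun f : 'rV_0 -> E => f (v i))
      (tangent_map_cst (M := nerve0) (N := G) e1 x)).
  rewrite /pullback -[LHS]/(- (6^-1 *: wedge1 Q mc_left
    (wedge1 lie_bracket mc_left mc_left) e1
    (tangent_map (M := nerve0) (N := G) degen00 x \o v) : R)).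
  rewrite /wedge1 big1 ?scaler0 ?oppr0 // => i _.
  by rewrite z Q0l scaler0.
Qed.

Definition Omega_bullet Q : normalized_form :=
  NormalizedForm (Omega_shifted_normalized Q).

Lemma ve22E b v w :
  ve22 b v w = - b (e1, e1) (fun i => if i == ord0 then (left_vf w e1, 0) else (0, left_vf v e1)).
Proof.
rewrite /ve22 /pullback /contract; congr (- b _ _); apply: funext => i.
rewrite /vcons /=; case: unliftP => [j ->|->]; last by rewrite eqxx.
by rewrite (ord1 j) unlift_none; exact: tangent_degen10.
Qed.

Lemma ve22_linear_l b w : (forall p, multilinear (b p)) -> linear (ve22 b ^~ w).
Proof.
move=> lb a u v; rewrite !ve22E.
pose z (t : E) i := if i == ord0 :> 'I_2 then (left_vf w e1, 0) else (0, t) : E * E.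
have e t : z t = subst_at (z 0) ord_max (0, t).
  by apply: funext => i; rewrite /subst_at /z; case: i => [[|[|//]]].
have h := lb (e1, e1) (z 0) ord_max a (0, left_vf u e1) (0, left_vf v e1).
have s : (0, left_vf (a *: u + v) e1) = a *: (0, left_vf u e1) + (0, left_vf v e1) :> E * E.
  by rewrite left_vf_linear; apply: injective_projections; rewrite //= scaler0 addr0.
have hh : b (e1, e1) (z (left_vf (a *: u + v) e1)) =
    a *: (b (e1, e1) (z (left_vf u e1)) : R) + b (e1, e1) (z (left_vf v e1)).
  rewrite (e (left_vf (a *: u + v) e1)) s h.
  by rewrite -(e (left_vf u e1)) -(e (left_vf v e1)).
rewrite -[LHS]/(- b (e1, e1) (z (left_vf (a *: u + v) e1))) hh opprD.
exact: (congr1 (fun t => t - _) (esym (scalerN _ _))).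
Qed.

Lemma ve22_linear_r b v : (forall p, multilinear (b p)) -> linear (ve22 b v).
Proof.
move=> lb a u w; rewrite !ve22E.
pose z (t : E) i := if i == ord0 :> 'I_2 then (t, 0) else (0, left_vf v e1) : E * E.
have e t : z t = subst_at (z 0) ord0 (t, 0).
  by apply: funext => i; rewrite /subst_at /z; case: i => [[|[|//]]].
have h := lb (e1, e1) (z 0) ord0 a (left_vf u e1, 0) (left_vf w e1, 0).
have s : (left_vf (a *: u + w) e1, 0) = a *: (left_vf u e1, 0) + (left_vf w e1, 0) :> E * E.
  by rewrite left_vf_linear; apply: injective_projections; rewrite //= scaler0 addr0.
have hh : b (e1, e1) (z (left_vf (a *: u + w) e1)) =
    a *: (b (e1, e1) (z (left_vf u e1)) : R) + b (e1, e1) (z (left_vf w e1)).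
  rewrite (e (left_vf (a *: u + w) e1)) s h.
  by rewrite -(e (left_vf u e1)) -(e (left_vf w e1)).
rewrite -[LHS]/(- b (e1, e1) (z (left_vf (a *: u + w) e1))) hh opprD.
exact: (congr1 (fun t => t - _) (esym (scalerN _ _))).
Qed.

(* For an arbitrary 2-form b the expression ve22 b v w need not be symmetric in
   v and w, so it is symmetrized to land in Sym^2; see ve22_symE. *)
Definition ve22_sym (b : form nerve2 R 2) : weil_fun E 2 2 :=
  fun _ v => 2^-1 * (ve22 b (v ord0) (v ord_max) + ve22 b (v ord_max) (v ord0)).

Lemma ve22_symE b : (forall u v, ve22 b u v = ve22 b v u) ->
  ve22_sym b = fun _ v => ve22 b (v ord0) (v ord_max).
Proof.
move=> sb; apply: funext => u; apply: funext => v; rewrite /ve22_sym (sb (v ord_max)).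
have H (x : R) : 2^-1 * (x + x) = x.
  by rewrite mulrDr -mulrDl -mulr2n -(mulr_natl (2^-1)) mulfV ?mul1r ?pnatr_eq0.
exact: H.
Qed.

Lemma weil22P (f : E -> E -> R) :
  (forall u, linear (f u)) -> (forall u v, f u v = f v u) ->
  (fun _ v => f (v ord0) (v ord_max)) \in @weil_pred E 2 2.
Proof.
move=> lf sf; apply/asboolP; rewrite /weil_space /=; split; last first.
  by move=> w; split=> [v []|v []].
move=> _; split.
  move=> v i a x y; rewrite /subst_at.
  case: i => [[|[|//]]] i /=; rewrite -?val_eqE /=.
    by rewrite !(sf _ (v _)) lf.
  by rewrite lf.
move=> v s /=; case: (altP (s ord0 =P ord0)) => s0.
  have -> : s ord_max = ord_max.
    have : s ord_max != ord0 by rewrite -s0 (inj_eq perm_inj).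
    by case: (s ord_max) => [[|[|//]]] // ? _; exact: val_inj.
  by rewrite s0.
have e : s ord0 = ord_max by move: s0; case: (s ord0) => [[|[|//]]] // ? _; exact: val_inj.
have -> : s ord_max = ord0.
  have : s ord_max != ord_max by rewrite -e (inj_eq perm_inj).
  by case: (s ord_max) => [[|[|//]]] // ? _; exact: val_inj.
by rewrite e sf.
Qed.

Lemma ve22_symP b : (forall p, multilinear (b p)) -> ve22_sym b \in @weil_pred E 2 2.
Proof.
move=> lb; apply: (weil22P (f := fun u v => 2^-1 * (ve22 b u v + ve22 b v u))).
  move=> u a x y; rewrite (ve22_linear_r _ lb) (ve22_linear_l _ lb) addrACA -scalerDr.
  by rewrite mulrDr -scalerAr.
by move=> u v; rewrite addrC.
Qed.

(* The components in W^{1,3} and W^{0,4}, which are zero spaces, vanish. *)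
Definition van_est (w : normalized_form) : weil E 2 2 * weil E 1 3 * weil E 0 4 :=
  (Weil (ve22_symP (let: And3 l _ _ := sform2_form (nformP w) in l)), 0, 0).

Definition qpair_weil Q : weil E 2 2 := Weil (weil22P (qpair_linearr Q) (qpair_sym Q)).
End LieGroup.


End LieGroups.

Arguments lieGroup R n : clear implicits.

(* Main.v *)
Require Import Defs.
From mathcomp Require Import all_boot all_order all_algebra.
From mathcomp Require Import reals topology normedtype.
From mathcomp Require Import boolp.
Import GRing.Theory.
Local Open Scope ring_scope.

(** At the unit every translation involved is the identity map, so evaluating
    [Omega] on [(w, 0)] and [(0, v)] there gives [<w, v>]; the other term of the
    wedge product pairs two zero vectors. *)

Section UnitTranslations.
Context {R : realType} {n : nat} (G : lieGroup R n).

Lemma lg_inv1 : lg_inv (lg_one G) = lg_one G.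
Proof. by rewrite -[LHS](lg_mulg1 (l := G)) lg_mulVg. Qed.

Lemma left_vf1 (v : 'rV[R]_n) : left_vf (G := G) v (lg_one G) = v.
Proof.
rewrite /left_vf (_ : (fun x => _) = id) ?tangent_map_id //.
by apply: funext => x; rewrite lg_mul1g.
Qed.

Lemma mc_left1 (v : 'I_1 -> 'rV[R]_n) : mc_left (lg_one G) v = v ord0.
Proof.
rewrite /mc_left (_ : (fun x => _) = id) ?tangent_map_id //.
by apply: funext => x; rewrite lg_inv1 lg_mul1g.
Qed.

Lemma mc_right1 (v : 'I_1 -> 'rV[R]_n) : mc_right (lg_one G) v = v ord0.
Proof.
rewrite /mc_right (_ : (fun x => _) = id) ?tangent_map_id //.
by apply: funext => x; rewrite lg_inv1 lg_mulg1.
Qed.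

Variable Q : quadratic_structure G.

Lemma qpair0r u : Q u 0 = 0.
(* With scalar [-1] and both vectors zero, linearity reads [Q u 0 = - Q u 0 + Q u 0]. *)
Proof. by have := qpair_linear Q u (-1) 0 0; rewrite scaler0 addr0 mulN1r addNr. Qed.

(** The faces are projections, so their tangent maps pick out components, on which both
    Maurer-Cartan forms act as the identity at the unit. *)
Lemma Omega1 (x : 'I_2 -> 'rV[R]_n * 'rV[R]_n) :
  Omega Q (lg_one G, lg_one G) x =
  Q (x ord0).1 (x ord_max).2 - Q (x ord_max).1 (x ord0).2.
Proof.
have lE (v : 'I_1 -> 'rV[R]_n * 'rV[R]_n) :
    pullback (M := nerve2 G) (face2 (G := G)) (mc_left (G := G))
      (lg_one G, lg_one G) v = (v ord0).1.
  exact: (etrans (mc_left1 _) (tangent_face2 _ _)).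
have rE (v : 'I_1 -> 'rV[R]_n * 'rV[R]_n) :
    pullback (M := nerve2 G) (face0 (G := G)) (mc_right (G := G))
      (lg_one G, lg_one G) v = (v ord0).2.
  exact: (etrans (mc_right1 _) (tangent_face0 _ _)).
rewrite /Omega /wedge1 !big_ord_recl big_ord0 /= addr0 expr0 expr1.
rewrite scale1r scaleN1r !lE !rE /=.
(* Omitting one of the two indices leaves the other. *)
rewrite (_ : lift ord0 ord0 = ord_max); last exact: val_inj.
by rewrite (_ : lift ord_max ord0 = ord0); last exact: val_inj.
Qed.

(** The contraction by [w] fills the first slot, so the value comes out as [- Q w v]; symmetry of
    [Q] restores the order. *)
Lemma ve22_Omega v w : ve22 (Omega Q) v w = - Q v w.
Proof. by rewrite ve22E Omega1 !left_vf1 /= qpair0r subr0 qpair_sym. Qed.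

End UnitTranslations.

Theorem proposition3p5 (R : realType) (n : nat) (G : lieGroup R n)
    (Q : quadratic_structure G) :
  van_est (Omega_bullet Q) = (- qpair_weil Q, 0, 0).
Proof.
congr (_, _, _); apply: val_inj => /=.
(* Only the component in [weil E 2 2] remains. There [ve22 (Omega Q)] is already symmetric, so
   symmetrization does not change it. *)
rewrite ve22_symE => [|u v]; last by rewrite !ve22_Omega qpair_sym.
by apply: funext => u; apply: funext => v; rewrite ve22_Omega.
Qed.
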